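(* Let $G$ be a left amenable (discrete) semigroup with a neutral element $e$ and let $m$ be a left-invariant mean on $\ell^\infty(G)$. Let $E\subseteq G$ with $m(\mathbf{1}_E)>0$ and let $\mathbb{X}=(X,\mathcal{B}_X,\mu,(T_g)_{g\in G})$ be a Furstenberg system for the pair $(E,m)$. Let $\mathbb{Y}=(Y,\mathcal{B}_Y,\nu,(S_g)_{g\in G})$ be the symbolic Furstenberg system for $(E,m)$, that is: $Y=\{0,1\}^G$, $(S_gx)_{g_0}=x_{g_0g}$ for all $g,g_0\in G$, $\nu$ is the unique regular Borel probability measure on $Y$ such that, with $B=\{x\in Y: x(e)=1\}$, $\nu((S_{g_1})^{-1}B\cap\dots\cap(S_{g_r})^{-1}B)=m(\mathbf{1}_{g_1^{-1}E}\cdots\mathbf{1}_{g_r^{-1}E})$ for all $r\in\mathbb{N}$ and $g_1,\dots,g_r\in G$, and $\mathcal{B}_Y$ is the completion of the Borel $\sigma$-algebra of $Y$. Then $(T_g)_{g\in G}$ and $(S_g)_{g\in G}$ are conjugate.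
   Context: $G$ is not assumed countable. A left-invariant mean on $G$ is a continuous linear functional $m:\ell^\infty(G)\to\mathbb{C}$ with $m({}_gf)=m(f)$ for all $f\in\ell^\infty(G)$, $g\in G$, where ${}_gf(x)=f(gx)$; $m(f)\ge0$ for $f\ge 0$; and $m(1)=1$. $G$ is left amenable if such a mean exists. $g^{-1}E=\{h\in G: gh\in E\}$. A measure preserving system $(X,\mathcal{B},\mu,(T_g)_{g\in G})$ is a probability space with a measure preserving action of $G$ ($T_gT_h=T_{gh}$, $T_e=\mathrm{id}$). Definition. Let $m$ be a left-invariant mean and $E\subseteq G$ with $m(\mathbf{1}_E)>0$. A measure preserving system $(X,\mathcal{B},\mu,(T_g)_{g\in G})$ (not assumed standard) is a Furstenberg system associated with $(E,m)$ if: (1) there is $A\in\mathcal{B}$ with $\mu(A)=m(\mathbf{1}_E)>0$; (2) for all $r\in\mathbb{N}$ and $g_1,\dots,g_r\in G$, $m(\mathbf{1}_{g_1^{-1}E}\cdots\mathbf{1}_{g_r^{-1}E})=\mu((T_{g_1})^{-1}A\cap\dots\cap(T_{g_r})^{-1}A)$; (3) $\mathcal{B}$ is (the completion of) the $\sigma$-algebra generated by $\{(T_g)^{-1}A: g\in G\}$. Conjugacy: $(T_g)_{g\in G}$ on $(X,\mathcal{B},\mu)$ and $(S_g)_{g\in G}$ on $(Y,\mathcal{C},\nu)$ are conjugate if there is an isomorphism $\Psi$ of measure algebras (sets modulo null sets) from that of $(Y,\mathcal{C},\nu)$ onto that of $(X,\mathcal{B},\mu)$ (a measure preserving bijection respecting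 complements and countable unions) such that $\Psi\circ S_g^{-1}=T_g^{-1}\circ\Psi$ for all $g\in G$. *)

(* Defs.v *)
From HB Require Import structures.
From mathcomp Require Import all_boot all_order all_algebra.
From mathcomp Require Import all_classical all_reals all_analysis.
From mathcomp Require Import complex.
Set Implicit Arguments. Unset Strict Implicit. Unset Printing Implicit Defensive.
Import Order.TTheory GRing.Theory Num.Theory.
Import numFieldNormedType.Exports.
Local Open Scope classical_set_scope.
Local Open Scope complex_scope.
Local Open Scope ring_scope.

Section ell_infty.
Context (R : realType) (G : Type).
Implicit Types f h : G -> R[i].

Definition bounded_pred : {pred G -> R[i]} :=
  [pred f : G -> R[i] | `[< exists M : R[i], forall x, `|f x| <= M >]].

Lemma bounded_predP f :
  reflect (exists M : R[i], forall x, `|f x| <= M) (f \in bounded_pred).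
Proof. exact: asboolP. Qed.

Lemma bounded_subring_closed : subring_closed bounded_pred.
Proof.
split=> [|f h /bounded_predP[M fM] /bounded_predP[N hN]|
  f h /bounded_predP[M fM] /bounded_predP[N hN]]; apply/bounded_predP.
- by exists 1 => x; rewrite (_ : _ x = 1)// normr1.
- exists (M + N) => x; rewrite (_ : _ x = f x - h x)//.
  by rewrite (le_trans (ler_normB _ _))// lerD.
- by exists (M * N) => x; rewrite (_ : _ x = f x * h x)// normrM ler_pM.
Qed.

Lemma bounded_scaler_closed : scaler_closed bounded_pred.
Proof.
move=> a f /bounded_predP[M fM]; apply/bounded_predP.
exists (`|a| * M) => x; rewrite (_ : _ x = a * f x)// normrM.
by rewrite ler_wpM2l.
Qed.

HB.instance Definition _ :=
  GRing.isSubringClosed.Build (G -> R[i]) bounded_pred bounded_subring_closed.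
HB.instance Definition _ := GRing.isScaleClosed.Build R[i] (G -> R[i])
  bounded_pred bounded_scaler_closed.

(* Bounded functions G -> C, a subring and subspace of G -> C; the norm,
   hence the topology, is the sup norm registered at the end of the section. *)
Record ell_infty := EllInfty {
  ell_fun :> G -> R[i] ;
  ell_bounded : ell_fun \in bounded_pred }.

HB.instance Definition _ := [isSub of ell_infty for ell_fun].
HB.instance Definition _ := [Choice of ell_infty by <:].
HB.instance Definition _ := GRing.SubChoice_isSubComPzRing.Build _ _ ell_infty
  (subringClosedP _).
HB.instance Definition _ := [SubZmodule_isSubLmodule of ell_infty by <:].

(* Norms over R[i] take values in R[i]; the supremum is taken in R. *)
Definition sup_norm (f : ell_infty) : R[i] :=
  (sup (range (fun x => complex.Re `|f x|)))%:C.

Let normCE (z : R[i]) : `|z| = (complex.Re `|z|)%:C.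
Proof. by rewrite normc_def. Qed.

Let has_ub (f : ell_infty) : has_ubound (range (fun x => complex.Re `|f x|)).
Proof.
case: f => f /= /bounded_predP[M fM]; exists (complex.Re M) => _ [x _ <-].
by have := fM x; rewrite lecE => /andP[].
Qed.

Lemma sup_norm_ge (f : ell_infty) x : `|f x| <= sup_norm f.
Proof. by rewrite normCE lecR; apply: ub_le_sup => //; exists x. Qed.

Lemma sup_norm_le (f : ell_infty) (M : R[i]) : 0 <= M ->
  (forall x, `|f x| <= M) -> sup_norm f <= M.
Proof.
rewrite [0 <= M]lecE/= => /andP[/eqP M0 M1] fM; rewrite lecE/= M0 eqxx/=.
have [->|/set0P rf0] := eqVneq (range (fun x => complex.Re `|f x|)) set0.
  by rewrite sup0.
by apply: ge_sup => // _ [x _ <-]; have := fM x; rewrite lecE => /andP[].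
Qed.

Lemma sup_norm_ge0 (f : ell_infty) : 0 <= sup_norm f.
Proof.
have [r0|/set0P[_ [x _ _]]] := eqVneq (range (fun x => complex.Re `|f x|)) set0.
  by rewrite /sup_norm r0 sup0.
exact: le_trans (sup_norm_ge f x).
Qed.

Let sup_normD (f h : ell_infty) : sup_norm (f + h) <= sup_norm f + sup_norm h.
Proof.
apply: sup_norm_le => [|x]; first by rewrite addr_ge0 ?sup_norm_ge0.
by rewrite (le_trans (ler_normD _ _))// lerD// sup_norm_ge.
Qed.

Let sup_norm_le1 (a : R[i]) (f : ell_infty) :
  sup_norm (a *: f) <= `|a| * sup_norm f.
Proof.
apply: sup_norm_le => [|x]; first by rewrite mulr_ge0 ?sup_norm_ge0.
by rewrite (_ : _ x = a * f x)// normrM ler_wpM2l// sup_norm_ge.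
Qed.

Let sup_normZ (a : R[i]) (f : ell_infty) :
  sup_norm (a *: f) = `|a| * sup_norm f.
Proof.
apply/eqP; rewrite eq_le sup_norm_le1/=; have [->|a0] := eqVneq a 0.
  by rewrite normr0 mul0r sup_norm_ge0.
by rewrite -ler_pdivlMl ?normr_gt0// -normfV -{1}[f]scale1r -(mulVf a0)
  -scalerA sup_norm_le1.
Qed.

Let sup_norm0_eq0 (f : ell_infty) : sup_norm f = 0 -> f = 0.
Proof.
move=> f0; apply: val_inj; apply/funext => x.
by have := sup_norm_ge f x; rewrite f0 normr_le0 => /eqP.
Qed.

HB.instance Definition _ := Lmodule_isNormed.Build R[i] ell_infty
  sup_normD sup_normZ sup_norm0_eq0.

End ell_infty.

Section left_invariant_mean.
Context (R : realType) (G : monoidType).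

Lemma left_translate_bounded (g : G) (f : ell_infty R G) :
  (fun x => f (g * x)%g) \in @bounded_pred R G.
Proof.
case: f => f /= /bounded_predP[M fM]; apply/bounded_predP.
by exists M => x; exact: fM.
Qed.

Definition left_translate (g : G) (f : ell_infty R G) : ell_infty R G :=
  EllInfty (left_translate_bounded g f).

Lemma indic_bounded (E : set G) : \1_E \in @bounded_pred R G.
Proof.
by apply/bounded_predP; exists 1 => x; rewrite indicE normr_nat; case: (x \in E).
Qed.

Definition ell_indic (E : set G) : ell_infty R G := EllInfty (indic_bounded E).

(* 0 <= z in R[i] means that z is real and nonnegative. *)
Definition left_invariant_mean (m : {linear ell_infty R G -> R[i]^o}) : Prop :=
  [/\ continuous m,
      forall (g : G) (f : ell_infty R G), m (left_translate g f) = m f,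
      forall f : ell_infty R G, (forall x, 0 <= f x) -> 0 <= m f
    & m 1 = 1].

Definition left_amenable : Prop :=
  exists m : {linear ell_infty R G -> R[i]^o}, left_invariant_mean m.

(* g^-1 E; no inverse of g is involved. *)
Definition left_preim (g : G) (E : set G) : set G := [set h | E (g * h)%g].

End left_invariant_mean.

Section completion.
Local Open Scope ereal_scope.
Context d (X : measurableType d) (R : realType).

(* The mu-completion of a sigma-algebra S: a member of S together with a
   subset of a mu-null member of S. *)
Definition completion_sets (S : set (set X)) (mu : set X -> \bar R) :
    set (set X) :=
  [set C | exists A N M,
    [/\ S A, S M, mu M = 0, N `<=` M & C = A `|` N]].

Variable mu : probability X R.

Local Notation mC := (completion_sets measurable mu).

Lemma completion_sets_set0 : mC set0.
Proof.
exists set0, set0, set0; split; [exact: measurable0|exact: measurable0| | |].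
- exact: measure0.
- exact: subset_refl.
- by rewrite setU0.
Qed.

Lemma completion_sets_setC C : mC C -> mC (~` C).
Proof.
move=> [A [N [M [mA mM M0 NM ->]]]].
exists (~` (A `|` M)), ((~` A `&` ~` N) `&` M), M; split => //.
- exact/measurableC/measurableU.
- rewrite !setCU; apply/seteqP; split=> x.
    by move=> [Ax Nx]; have [Mx|Mx] := pselect (M x); [right|left].
  by move=> [[Ax Mx]|[[Ax Nx] _]//]; split=> // /NM.
Qed.

Lemma completion_sets_bigcup (C : (set X)^nat) :
  (forall i, mC (C i)) -> mC (\bigcup_i C i).
Proof.
move=> /(_ _)/cid-/all_sig[A] /(_ _)/cid-/all_sig[N] /(_ _)/cid-/all_sig[M] H.
exists (\bigcup_i A i), (\bigcup_i N i), (\bigcup_i M i); split.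
- by apply: bigcup_measurable => i _; case: (H i).
- by apply: bigcup_measurable => i _; case: (H i).
- apply: measure_negligible; first by apply: bigcup_measurable => i _; case: (H i).
  by apply: negligible_bigcup => i; case: (H i) => _ ? ? _ _; exact/negligibleP.
- by apply: subset_bigcup => i _; case: (H i).
- by rewrite -bigcupU; apply: eq_bigcupr => i _; case: (H i).
Qed.

Definition completion (mu : probability X R) : Type := X.

HB.instance Definition _ := Pointed.on (completion mu).
Definition completion_display : (set X -> \bar R) -> measure_display.
Proof. exact. Qed.
HB.instance Definition _ := isMeasurable.Build (completion_display mu)
  (completion mu)
  completion_sets_set0 completion_sets_setC completion_sets_bigcup.

(* The outer measure of mu: sends A `|` N to mu A for A measurable and N
   negligible. *)
Definition completed : set (completion mu) -> \bar R := (mu^*)%mu.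

Let completedE (A N M : set X) : measurable A -> measurable M -> mu M = 0 ->
  N `<=` M -> completed (A `|` N) = mu A.
Proof.
move=> mA mM M0 NM; apply/eqP; rewrite eq_le; apply/andP; split.
  rewrite -[leRHS](_ : mu (A `|` M) = _).
    rewrite -measurable_mu_extE; last exact: measurableU.
    by apply: le_outer_measure; exact: setUS.
  by rewrite measureU0.
by rewrite -[leLHS]measurable_mu_extE//; apply: le_outer_measure.
Qed.

Let completed0 : completed set0 = 0.
Proof. exact: outer_measure0. Qed.

Let completed_ge0 C : 0 <= completed C.
Proof. exact: outer_measure_ge0. Qed.

Let completed_sigma_additive : semi_sigma_additive completed.
Proof.
move=> C mC tC mUC.
have [A /(_ _)/cid-/all_sig[N] /(_ _)/cid-/all_sig[M] H] := all_sig (fun i => cid (mC i)).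
have mA i : measurable (A i) by case: (H i).
have mM i : measurable (M i) by case: (H i).
have M0 i : mu (M i) = 0 by case: (H i).
have NM i : N i `<=` M i by case: (H i).
have CE i : C i = A i `|` N i by case: (H i).
have -> : (fun n => \sum_(0 <= i < n) completed (C i)) =
          (fun n => \sum_(0 <= i < n) mu (A i)).
  by apply/funext => n; apply: eq_bigr => i _; rewrite CE (completedE _ (mM i)).
have -> : \bigcup_i C i = \bigcup_i A i `|` \bigcup_i N i.
  by rewrite -bigcupU; apply: eq_bigcupr => i _; exact: CE.
have mUA : measurable (\bigcup_i A i) by apply: bigcup_measurable => i _.
have mUM : measurable (\bigcup_i M i) by apply: bigcup_measurable => i _.
have MU0 : mu (\bigcup_i M i) = 0.
  apply: measure_negligible => //.
  by apply: negligible_bigcup => i; apply/(negligibleP _ (mM i)); exact: M0.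
have NUM : \bigcup_i N i `<=` \bigcup_i M i
  by apply: subset_bigcup => i _; exact: NM.
rewrite (completedE mUA mUM MU0 NUM).
apply: measure_semi_sigma_additive => // i j Di Dj [x [Aix Ajx]].
by apply: (tC i j Di Dj); exists x; split; rewrite CE; left.
Qed.

HB.instance Definition _ := isMeasure.Build _ (completion mu) R completed
  completed0 completed_ge0 completed_sigma_additive.

Let completedT : completed setT = 1.
Proof.
by rewrite -[setT](setU0 setT) (@completedE _ _ set0) ?probability_setT.
Qed.

HB.instance Definition _ := Measure_isProbability.Build _ (completion mu) R completed
  completedT.

End completion.
Arguments completed {d X R} mu C.

Section measure_algebra.
Local Open Scope quotient_scope.
Context d (X : measurableType d) (R : realType).

Record meas_set := MeasSet {
  meas_set_set :> set X ;
  meas_set_measurable : measurable meas_set_set }.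

HB.instance Definition _ := gen_eqMixin meas_set.
HB.instance Definition _ := gen_choiceMixin meas_set.

Definition meas_set_setC (A : meas_set) : meas_set :=
  MeasSet (measurableC (meas_set_measurable A)).

Definition meas_set_bigcup (F : meas_set^nat) : meas_set :=
  MeasSet (bigcup_measurable (fun k (_ : setT k) => meas_set_measurable (F k))).

Lemma measurable_preimage (f : {mfun X >-> X}) (A : meas_set) :
  measurable (f @^-1` A).
Proof.
rewrite -[_ @^-1` _]setTI; apply: measurable_funPT => //.
exact: meas_set_measurable.
Qed.

Definition meas_set_preimage (f : {mfun X >-> X}) (A : meas_set) : meas_set :=
  MeasSet (measurable_preimage f A).

Variable mu : probability X R.

Definition meas_set_eqv (A B : meas_set) : bool := `[< mu (A `+` B) = 0%E >].

Let measurable_setY (A B : meas_set) : measurable (A `+` B).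
Proof. by apply: measurableU; apply: measurableD; exact: meas_set_measurable. Qed.

Let meas_set_eqvP (A B : meas_set) : meas_set_eqv A B <-> mu.-negligible (A `+` B).
Proof.
by split=> [/asboolP|/negligibleP AB];
  [move/(negligibleP _ (measurable_setY A B))|apply/asboolP; exact: AB].
Qed.

Let meas_set_eqv_refl : reflexive meas_set_eqv.
Proof. by move=> A; apply/asboolP; rewrite setYK measure0. Qed.

Let meas_set_eqv_sym : symmetric meas_set_eqv.
Proof. by move=> A B; rewrite /meas_set_eqv setYC. Qed.

Let meas_set_eqv_trans : transitive meas_set_eqv.
Proof.
move=> B A C /meas_set_eqvP AB /meas_set_eqvP BC; apply/meas_set_eqvP.
apply: negligibleS (negligibleU AB BC) => x [[Ax Cx]|[Cx Ax]];
  have [Bx|Bx] := pselect (meas_set_set B x).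
- by right; left.
- by left; left.
- by left; right.
- by right; right.
Qed.

Canonical meas_set_equiv :=
  EquivRel meas_set_eqv meas_set_eqv_refl meas_set_eqv_sym meas_set_eqv_trans.

Definition measure_algebra := {eq_quot meas_set_equiv}%qT.

(* The operations are computed on representatives; the lemmas *_pi below show
   that they do not depend on the choice. *)
Definition malg_measure (a : measure_algebra) : \bar R := mu (repr a).

Definition malg_compl (a : measure_algebra) : measure_algebra :=
  \pi_(measure_algebra) (meas_set_setC (repr a)).

Definition malg_bigcup (F : measure_algebra^nat) : measure_algebra :=
  \pi_(measure_algebra) (meas_set_bigcup (fun n => repr (F n))).

(* Independent of the representative when f preserves mu. *)
Definition malg_preimage (f : {mfun X >-> X}) (a : measure_algebra) :
    measure_algebra :=
  \pi_(measure_algebra) (meas_set_preimage f (repr a)).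

Lemma pi_meas_set_eqvP (A B : meas_set) :
  (\pi_(measure_algebra) A = \pi_(measure_algebra) B) <->
  mu.-negligible (A `+` B).
Proof.
rewrite -meas_set_eqvP; split=> [/eqmodP//|AB]; exact/eqmodP.
Qed.

Let repr_negligible (A : meas_set) :
  mu.-negligible (repr (\pi_(measure_algebra) A) `+` A).
Proof. by apply/pi_meas_set_eqvP; rewrite reprK. Qed.

Lemma malg_measure_pi (A : meas_set) : malg_measure (\pi_(measure_algebra) A) = mu A.
Proof.
rewrite /malg_measure; set B := repr _.
have mB := meas_set_measurable B; have mA := meas_set_measurable A.
have BA : mu.-negligible (B `\` A).
  by apply: negligibleS (repr_negligible A) => x; left.
have AB : mu.-negligible (A `\` B).
  by apply: negligibleS (repr_negligible A) => x; right.
have BA0 := measure_negligible (measurableD mB mA) BA.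
have AB0 := measure_negligible (measurableD mA mB) AB.
by rewrite (measureDI mu mB mA) (measureDI mu mA mB) BA0 AB0 setIC.
Qed.

Lemma malg_compl_pi (A : meas_set) :
  malg_compl (\pi_(measure_algebra) A) = \pi_(measure_algebra) (meas_set_setC A).
Proof.
apply/pi_meas_set_eqvP; apply: negligibleS (repr_negligible A) => x /=.
by move=> [[Bx /contrapT Ax]|[Ax /contrapT Bx]]; [right|left].
Qed.

Lemma malg_bigcup_pi (F : meas_set^nat) :
  malg_bigcup (fun n => \pi_(measure_algebra) (F n)) =
  \pi_(measure_algebra) (meas_set_bigcup F).
Proof.
apply/pi_meas_set_eqvP.
apply: negligibleS (negligible_bigcup (fun n => repr_negligible (F n))).
move=> x [[[n _ Bx] Fx]|[[n _ Fx] Bx]]; exists n => //; [left|right].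
  by split=> // Fnx; apply: Fx; exists n.
by split=> // Bnx; apply: Bx; exists n.
Qed.

Lemma malg_preimage_pi (f : {mfun X >-> X}) (A : meas_set) :
  (forall B, measurable B -> mu (f @^-1` B) = mu B) ->
  malg_preimage f (\pi_(measure_algebra) A) =
  \pi_(measure_algebra) (meas_set_preimage f A).
Proof.
move=> fmu; apply/pi_meas_set_eqvP; set B := repr _.
have mBA := measurable_setY B A.
exists (f @^-1` (B `+` A)); split => //.
- exact: (measurable_preimage f (MeasSet mBA)).
- by rewrite fmu//; apply/(negligibleP _ mBA); exact: repr_negligible.
Qed.

End measure_algebra.

Section measure_preserving.
Context (G : monoidType) (R : realType).

Record mp_action d (X : measurableType d) (mu : probability X R) := MPAction {
  mp_fun :> G -> {mfun X >-> X} ;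
  mp_measure : forall g (A : set X),
    measurable A -> mu (mp_fun g @^-1` A) = mu A ;
  mp_mul : forall g h x, mp_fun g (mp_fun h x) = mp_fun (g * h)%g x ;
  mp_one : forall x, mp_fun 1%g x = x }.

(* Psi o S_g^-1 = T_g^-1 o Psi as maps of measure algebras. *)
Definition conjugate_systems d (X : measurableType d) (mu : probability X R)
    d' (Y : measurableType d') (nu : probability Y R)
    (T : mp_action mu) (S : mp_action nu) : Prop :=
  exists Psi : measure_algebra nu -> measure_algebra mu,
    [/\ bijective Psi,
        forall b, malg_measure (Psi b) = malg_measure b,
        forall b, Psi (malg_compl b) = malg_compl (Psi b),
        forall F : (measure_algebra nu)^nat,
          Psi (malg_bigcup F) = malg_bigcup (fun n => Psi (F n))
      & forall g b, Psi (malg_preimage (S g) b) = malg_preimage (T g) (Psi b)].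

End measure_preserving.

Section furstenberg.
Context (R : realType) (G : monoidType).
Variables (E : set G) (m : {linear ell_infty R G -> R[i]^o}).

(* All the measures involved are finite, so fine loses nothing. The case r = 0
   reads m 1 = mu X and always holds. The last clause: the sigma-algebra of X is
   the one generated by the translates of A, or the completion of that one. *)
Definition furstenberg_system d (X : measurableType d) (mu : probability X R)
    (T : mp_action G mu) : Prop :=
  exists A : set X,
    let translates := [set T g @^-1` A | g in [set: G]] in
    [/\ measurable A,
        (fine (mu A))%:C = m (ell_indic R E) /\ (0 < mu A)%E,
        forall (r : nat) (g : 'I_r -> G),
          m (\prod_(i < r) ell_indic R (left_preim (g i) E)) =
          (fine (mu (\bigcap_i (T (g i) @^-1` A))))%:C
      & measurable = <<s translates >> \/
        measurable = completion_sets <<s translates >> mu].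

End furstenberg.

Definition borel (T : ptopologicalType) := g_sigma_algebraType (@open T).

Definition regular_measure (R : realType) (T : ptopologicalType)
    (nu : set (borel T) -> \bar R) : Prop :=
  forall B : set (borel T), measurable B ->
    nu B = ereal_sup [set nu K | K in [set K : set T | compact K /\ K `<=` B]] /\
    nu B = ereal_inf [set nu U | U in [set U : set T | open U /\ B `<=` U]].

Section symbolic.
Context (R : realType) (G : monoidType).

Definition symbolic_space : Type := {ptws G -> bool}.

HB.instance Definition _ := Topological.on symbolic_space.
HB.instance Definition _ := Pointed.on symbolic_space.

(* Right translation: shift by g after shift by h is shift by g * h. *)
Definition symbolic_shift (g : G) (x : symbolic_space) : symbolic_space :=
  fun g0 => x (g0 * g)%g.

Definition symbolic_measure (E : set G) (m : {linear ell_infty R G -> R[i]^o})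
    (nu : probability (borel symbolic_space) R) : Prop :=
  let B := [set x : symbolic_space | x 1%g = true] in
  regular_measure nu /\
  forall (r : nat) (g : 'I_r -> G),
    (fine (nu (\bigcap_i (symbolic_shift (g i) @^-1` B))))%:C =
    m (\prod_(i < r) ell_indic R (left_preim (g i) E)).

End symbolic.

(* Main.v *)
Require Import Defs.
From HB Require Import structures.
From mathcomp Require Import all_boot all_order all_algebra.
From mathcomp Require Import all_classical all_reals all_analysis.
From mathcomp Require Import complex finmap lra.
Set Implicit Arguments.
Unset Strict Implicit.
Unset Printing Implicit Defensive.
Import Order.TTheory GRing.Theory Num.Theory.
Import numFieldNormedType.Exports.
Local Open Scope classical_set_scope.
Local Open Scope complex_scope.
Local Open Scope ring_scope.

(** The two systems are linked by the itinerary map pi : X -> {0,1}^G, where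
pi(x)(g) says whether T_g x lies in A. It intertwines T_g with the shift S_g
and pulls the cylinder [y(g) = 1] back to T_g^-1 A. The sets in the
sigma-algebra generated by the cylinders are the Baire sets.

On Baire sets the measure nu is the image of mu under pi: both assign to a finite
intersection of cylinders the value that the mean prescribes, and such
intersections form a pi-system ([itinerary_measure]). Hence pulling back by pi
is a measure preserving homomorphism from the Baire sets, modulo null sets, into
the measure algebra of X. It is onto because the translates of A generate the
sigma-algebra of X up to null sets ([itinerary_dense]).

When G is uncountable there are Borel sets that are not Baire, and pi need not
be Borel measurable; this is where the regularity of nu enters.
Between a compact set and an open set containing it there is a finite union of
basic sets, which is a Baire set. Approximating a Borel set from inside by compact
sets and from outside by open ones therefore shows that it differs from a Baire
set by a null set ([regular_approx]), so that the measure algebra of the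
completion of nu is that of the Baire sets, and the homomorphism above is the required
conjugacy ([conjugate_factor]).

It remains to see that the shifts preserve nu on all Borel sets, not only on Baire
sets, where invariance is inherited from mu. This is the same compact-open sandwich
([regular_invariant]). *)

(** * Sigma-algebras and maps *)

Lemma g_sigma_algebra_preimage_sub T U (f : T -> U) (P : set (set T))
    (C : set (set U)) : sigma_algebra setT P ->
  (forall B, C B -> P (f @^-1` B)) -> forall B, <<s C>> B -> P (f @^-1` B).
Proof.
move=> sP CP B; rewrite -[_ @^-1` _]setTI.
apply: (@smallest_sub _ _ _ (image_set_system setT f P)); last first.
  by move=> D /CP; rewrite /image_set_system/= setTI.
exact: sigma_algebra_image.
Qed.

(** Dynkin's uniqueness theorem for nu and the image of mu under f. It
is phrased with preimages because the image measure may exist only on the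
sigma-algebra generated by C. *)
Lemma eq_probability_preimage (R : realType) d d' (X : measurableType d)
    (Y : measurableType d') (mu : probability X R) (nu : probability Y R)
    (f : X -> Y) (C : set (set Y)) : setI_closed C ->
  (forall B, C B -> [/\ measurable B, measurable (f @^-1` B)
    & mu (f @^-1` B) = nu B]) ->
  forall B, <<s C>> B -> mu (f @^-1` B) = nu B.
Proof.
move=> CI CH B CB.
pose H := [set B | [/\ measurable B, measurable (f @^-1` B)
  & mu (f @^-1` B) = nu B]].
suff : <<s C>> `<=` H by move=> /(_ _ CB)[].
apply: lambda_system_subset => //.
apply/dynkin_lambda_system; split.
- by split; [|rewrite preimage_setT|rewrite preimage_setT !probability_setT].
- move=> D [mD mfD muD]; split; [exact: measurableC| |].
    by rewrite preimage_setC; exact: measurableC.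
  by rewrite preimage_setC !probability_setC// muD.
- move=> F tF FH; have mF n : measurable (F n) by case: (FH n).
  have mfF n : measurable (f @^-1` F n) by case: (FH n).
  split; [exact: bigcupT_measurable| |].
    by rewrite preimage_bigcup; exact: bigcupT_measurable.
  rewrite preimage_bigcup !measure_bigcup//; last first.
    by move=> i j _ _ [x [Fix Fjx]]; apply: tF => //; exists (f x).
  by apply: eq_eseriesr => n _; case: (FH n).
Qed.

(** * Measure algebra isomorphisms induced by factor maps *)

Lemma meas_set_ext d (X : measurableType d) (A B : meas_set X) :
  A = B :> set X -> A = B.
Proof.
by case: A B => [A mA] [B mB] /= AB; case: B / AB mB => mB; congr MeasSet.
Qed.

(** The map f may fail to be measurable from X to Y: all that is required is that
it be measurable and measure preserving for a sigma-algebra on Y that exhausts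
the measurable sets of Y up to null sets. *)
Section factor_conjugacy.
Context (R : realType) d d' (X : measurableType d) (Y : measurableType d').
Variables (mu : probability X R) (nu : probability Y R).
Variables (C : set (set Y)) (f : X -> Y).
Local Notation mC := <<s C>>.
Hypothesis mCY : forall D, mC D -> measurable D.
Hypothesis mfC : forall D, mC D -> measurable (f @^-1` D).
Hypothesis fmu : forall D, mC D -> mu (f @^-1` D) = nu D.
Hypothesis C_dense : forall B : set Y, measurable B ->
  exists2 D, mC D & nu.-negligible (B `+` D).
Hypothesis fC_dense : forall A : set X, measurable A ->
  exists2 D, mC D & mu.-negligible (A `+` f @^-1` D).

Local Notation clsY mD := (\pi_(measure_algebra nu)%qT (MeasSet (mCY mD))).
Local Notation clsX mD := (\pi_(measure_algebra mu)%qT (MeasSet (mfC mD))).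

Let mC_setY D D' : mC D -> mC D' -> mC (D `+` D').
Proof.
move=> mD mD'; apply: (@measurableU _ (g_sigma_algebraType C));
  exact: (@measurableD _ (g_sigma_algebraType C)).
Qed.

Let clsY_surj (b : measure_algebra nu) : {D : set Y | {mD : mC D | b = clsY mD}}.
Proof.
apply: cid; have [D mD BD] := C_dense (meas_set_measurable (repr b)).
exists D; apply: cid; exists mD.
by rewrite -[LHS]reprK; apply/pi_meas_set_eqvP.
Qed.

Let clsX_surj (a : measure_algebra mu) : exists D (mD : mC D), a = clsX mD.
Proof.
have [D mD BD] := fC_dense (meas_set_measurable (repr a)).
by exists D, mD; rewrite -[LHS]reprK; apply/pi_meas_set_eqvP.
Qed.

(* Pulling back by f preserves the measure of symmetric differences, which gives
   well-definedness and injectivity at once. *)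
Let cls_eq D D' (mD : mC D) (mD' : mC D') :
  clsY mD = clsY mD' <-> clsX mD = clsX mD'.
Proof.
have mDD' := mC_setY mD mD'.
have DD' : nu.-negligible (D `+` D') <-> mu.-negligible (f @^-1` (D `+` D')).
  split=> [/(negligibleP _ (mCY mDD')) N|/(negligibleP _ (mfC mDD')) N].
    by apply/(negligibleP _ (mfC mDD')); exact: etrans (fmu mDD') N.
  by apply/(negligibleP _ (mCY mDD')); exact: etrans (esym (fmu mDD')) N.
by split=> /pi_meas_set_eqvP /DD' ?; exact/pi_meas_set_eqvP.
Qed.

(** The pullback by f of a chosen representative in the sigma-algebra generated by
C; the lemma [factor_isoE] shows that the choice is immaterial. *)
Definition factor_iso (b : measure_algebra nu) : measure_algebra mu :=
  let: exist _ (exist mD _) := clsY_surj b in clsX mD.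

Lemma factor_isoE D (mD : mC D) : factor_iso (clsY mD) = clsX mD.
Proof.
by rewrite /factor_iso; case: clsY_surj => D' [mD' DD']; exact/esym/cls_eq.
Qed.

(** A form of [factor_isoE] in which the measurability proofs packed in the two
representatives are arbitrary. *)
Lemma factor_iso_pi (B : meas_set Y) (A : meas_set X) : mC B ->
  A = f @^-1` B :> set X ->
  factor_iso (\pi_(measure_algebra nu)%qT B) = \pi_(measure_algebra mu)%qT A.
Proof.
move=> CB AB; transitivity (factor_iso (clsY CB)).
  by congr (factor_iso (\pi_(_)%qT _)); exact: meas_set_ext.
by rewrite factor_isoE; congr (\pi_(_)%qT _); exact: meas_set_ext.
Qed.

Lemma factor_iso_bij : bijective factor_iso.
Proof.
rewrite -setTT_bijective; split=> // [b b' _ _|a _].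
  case: (clsY_surj b) => D [mD ->]; case: (clsY_surj b') => D' [mD' ->].
  by rewrite !factor_isoE => /cls_eq.
by have [D [mD ->]] := clsX_surj a; exists (clsY mD); rewrite ?factor_isoE.
Qed.

Lemma factor_iso_measure b : malg_measure (factor_iso b) = malg_measure b.
Proof.
case: (clsY_surj b) => D [mD ->].
by rewrite factor_isoE !malg_measure_pi/= fmu.
Qed.

Lemma factor_iso_compl b :
  factor_iso (malg_compl b) = malg_compl (factor_iso b).
Proof.
case: (clsY_surj b) => D [mD ->]; rewrite factor_isoE !malg_compl_pi.
by apply: factor_iso_pi => //; exact: (@measurableC _ (g_sigma_algebraType C)).
Qed.

Lemma factor_iso_bigcup (F : (measure_algebra nu)^nat) :
  factor_iso (malg_bigcup F) = malg_bigcup (fun n => factor_iso (F n)).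
Proof.
have [D /all_sig[mD FE]] := all_sig (fun n => clsY_surj (F n)).
rewrite (_ : F = fun n => clsY (mD n)); last exact/funext.
rewrite malg_bigcup_pi (_ : (fun n => _) = fun n => clsX (mD n)); last first.
  by apply/funext => n; rewrite factor_isoE.
rewrite malg_bigcup_pi; apply: factor_iso_pi; last by rewrite preimage_bigcup.
by apply: (@bigcup_measurable _ (g_sigma_algebraType C)) => k _; exact: mD.
Qed.

(** An equivariant factor map induces a conjugacy. The last hypothesis keeps the
computation of the preimages under S inside the sets on which f can be pulled
back. *)
Lemma conjugate_factor (G : monoidType) (T : mp_action G mu)
    (S : mp_action G nu) :
  (forall g x, f (T g x) = S g (f x)) ->
  (forall g D, mC D -> mC (S g @^-1` D)) ->
  conjugate_systems T S.
Proof.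
move=> fTS mSC; exists factor_iso; split.
- exact: factor_iso_bij.
- exact: factor_iso_measure.
- exact: factor_iso_compl.
- exact: factor_iso_bigcup.
- move=> g b; case: (clsY_surj b) => D [mD ->].
  rewrite factor_isoE !malg_preimage_pi; [|exact: mp_measure..].
  apply: factor_iso_pi; first exact: mSC.
  by apply/funext => x; rewrite /preimage/= fTS.
Qed.

End factor_conjugacy.

Lemma continuous_borel_preimage (T U : ptopologicalType) (f : T -> U) :
  continuous f -> forall B : set (borel U), measurable B ->
  measurable (f @^-1` B : set (borel T)).
Proof.
move=> cf; apply: g_sigma_algebra_preimage_sub.
  exact: smallest_sigma_algebra.
by move=> V oV; apply: sub_gen_smallest; exact: open_comp.
Qed.

(** * Regular Borel probabilities and a generated sub-sigma-algebra *)

Section regular_probability.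
Context (R : realType) (T : ptopologicalType) (nu : probability (borel T) R).
Hypotheses (nu_reg : regular_measure nu) (hausT : hausdorff_space T).
Variable C : set (set T).
Local Notation mC := <<s C>>.
Hypothesis mC_base : forall (U : set T) x, open U -> U x ->
  exists W : set T, [/\ open W, mC W, W x & W `<=` U].
Hypothesis mC_borel : forall W : set (borel T), mC W -> measurable W.

(** Compactness replaces the arbitrary union of basic sets that makes up an open
set by a finite one, and only the latter is sure to stay in the sigma-algebra
generated by C. *)
Lemma compact_open_between (K U : set T) : compact K -> open U -> K `<=` U ->
  exists2 W, mC W & K `<=` W /\ W `<=` U.
Proof.
rewrite compact_cover => cK oU KU.
have [|x Kx|D DW KD] := cK _ [set W | [/\ open W, mC W & W `<=` U]] id.
- by move=> W [].
- have [W [oW CW Wx WU]] := mC_base oU (KU _ Kx).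
  by exists W.
exists (\bigcup_(W in [set` D]) W); last split=> //.
  apply: (@fin_bigcup_measurable _ (g_sigma_algebraType C)) => // W.
  by move=> /DW /set_mem[].
by apply: bigcup_sub => W /DW /set_mem[].
Qed.

Lemma measurable_compact (K : set T) : compact K -> measurable (K : set (borel T)).
Proof.
move=> /(compact_closed hausT) /closed_openC oK.
by rewrite -[K]setCK; apply: measurableC; exact: sub_gen_smallest.
Qed.

Lemma measurable_open (U : set T) : open U -> measurable (U : set (borel T)).
Proof. exact: sub_gen_smallest. Qed.

(** Choose compact K_n inside B and open U_k around B, all within 1/(n+1) of B in
measure, and W(n, k) between K_n and U_k. The union over n of the intersections
over k of the W(n, k) contains every K_n and lies in every U_k, as B does; so it
differs from B only inside the intersection of the U_n \ K_n, a null set. Using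
two indices spares making the K_n and the U_k monotone. *)
Lemma regular_approx (B : set (borel T)) : measurable B ->
  exists2 D, mC D & nu.-negligible (B `+` D).
Proof.
move=> mB; have [nuK nuU] := nu_reg mB.
have nuBfin : nu B \is a fin_num by exact: fin_num_measure.
have e0 n : (0 < n.+1%:R^-1 :> R)%R by rewrite invr_gt0.
have K_ n : exists K : set T,
    [/\ compact K, K `<=` B & (nu B - n.+1%:R^-1%:E < nu K)%E].
  have := nuBfin; rewrite nuK => /(ub_ereal_sup_adherent (e0 n))[_ [K [cK KB] <-]].
  by rewrite -nuK; exists K.
have U_ n : exists U : set T,
    [/\ open U, B `<=` U & (nu U < nu B + n.+1%:R^-1%:E)%E].
  have := nuBfin; rewrite nuU => /(lb_ereal_inf_adherent (e0 n))[_ [U [oU BU] <-]].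
  by rewrite -nuU; exists U.
have [K /all_and3[cK KB nuKn]] := choice K_.
have [U /all_and3[oU BU nuUn]] := choice U_.
have W_ (nk : nat * nat) : exists W, [/\ mC W, K nk.1 `<=` W & W `<=` U nk.2].
  have KU := subset_trans (KB nk.1) (BU nk.2).
  have [W mW [KW WU]] := compact_open_between (cK nk.1) (oU nk.2) KU.
  by exists W.
have [W /all_and3[mW KW WU]] := choice W_.
exists (\bigcup_n \bigcap_k W (n, k)).
  apply: (@bigcupT_measurable _ (g_sigma_algebraType C)) => n.
  by apply: (@bigcapT_measurable _ (g_sigma_algebraType C)) => k; exact: mW.
have mK n := measurable_compact (cK n); have mU n := measurable_open (oU n).
pose N := \bigcap_n (U n `\` K n).
have mN : measurable (N : set (borel T)).
  by apply: bigcapT_measurable => n; exact: measurableD.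
exists N; split=> //.
  suff Nle n : (nu N <= (2 * n.+1%:R^-1)%:E)%E.
    apply/eqP; rewrite -measure_le0; apply/lee_addgt0Pr => e e0'.
    have [|n] := @ltr_add_invr R 0 (e / 2); first by rewrite divr_gt0.
    rewrite !add0e add0r => ne; apply: (le_trans (Nle n)).
    by rewrite lee_fin mulrC -ler_pdivlMr// ltW.
  have KU : K n `<=` U n by exact: subset_trans (BU n).
  apply: (@le_trans _ _ (nu (U n `\` K n))).
    apply: le_measure; last exact: bigcap_inf.
      exact: mem_set.
    by apply: mem_set; exact: (@measurableD _ (borel T)).
  have -> : (nu (U n `\` K n) = nu (U n) - nu (K n))%E.
    rewrite measureD//; last by rewrite ltey_eq fin_num_measure.
    by rewrite setIidr.
  move: (nuKn n) (nuUn n); rewrite -(fineK nuBfin).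
  have /fineK <- := fin_num_measure nu _ (mK n).
  have /fineK <- := fin_num_measure nu _ (mU n).
  rewrite -!EFinB -!EFinD !lte_fin lee_fin.
  move: (fine (nu B)) (fine (nu (K n))) (fine (nu (U n))) n.+1%:R^-1 => b k u q.
  by lra.
move=> x [[Bx nWx]|[[n0 _ Wx] nBx]] n _; split.
- exact: BU.
- by move=> Knx; apply: nWx; exists n => // k _; exact: (KW (n, k)).
- exact/(WU (n0, n))/Wx.
- by move=> /KB.
Qed.

(** Let B be contained in an open U. A compact K inside f^-1 U has compact image in
U, and some W in the sigma-algebra generated by C fits between f K and U, so
nu K <= nu (f^-1 W) = nu W <= nu U. Inner regularity at f^-1 U and outer
regularity at B give nu (f^-1 B) <= nu B, and the complement of B gives the
converse. *)
Lemma regular_invariant (f : T -> T) : continuous f ->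
  (forall W, mC W -> nu (f @^-1` W) = nu W) ->
  forall B : set (borel T), measurable B -> nu (f @^-1` B) = nu B.
Proof.
move=> cf fC.
have mf := continuous_borel_preimage cf.
have fle (B : set (borel T)) : measurable B -> (nu (f @^-1` B) <= nu B)%E.
  move=> mB; rewrite (nu_reg mB).2; apply: le_ereal_inf_tmp => _ [U [oU BU] <-].
  have mU := measurable_open oU.
  apply: (@le_trans _ _ (nu (f @^-1` U))).
    by apply: le_measure; [apply: mem_set; exact: mf..|exact: preimage_subset].
  rewrite (nu_reg (mf _ mU)).1; apply: ge_ereal_sup => _ [K [cK KU] <-].
  have [||W mW [KW WU]] := @compact_open_between (f @` K) U _ oU.
  - by apply: continuous_compact => //; exact: continuous_subspaceT.
  - by move=> _ [x Kx <-]; exact: KU.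
  have mWb := mC_borel mW.
  apply: (@le_trans _ _ (nu (f @^-1` W))).
    apply: le_measure;
      [apply: mem_set; exact: measurable_compact|apply: mem_set; exact: mf|].
    by move=> x Kx; apply: KW; exists x.
  by rewrite fC//; apply: le_measure => //; exact: mem_set.
move=> B mB; apply/eqP; rewrite eq_le fle//=.
have := fle _ (measurableC mB).
rewrite -preimage_setC !probability_setC//; last exact: mf.
have /fineK <- := fin_num_measure nu _ mB.
have /fineK <- := fin_num_measure nu _ (mf _ mB).
by rewrite -!EFinB !lee_fin; lra.
Qed.

End regular_probability.

(** * Completions *)

Section completion.
Local Open Scope ereal_scope.
Context d (X : measurableType d) (R : realType) (mu : probability X R).

Lemma measurable_completion (A : set X) : measurable A ->
  measurable (A : set (completion mu)).
Proof. by move=> mA; exists A, set0, set0; split; rewrite ?setU0. Qed.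

Lemma completedE (A : set X) : measurable A -> completed mu A = mu A.
Proof. by move=> mA; rewrite /completed measurable_mu_extE. Qed.

Lemma negligible_completed (N : set X) :
  mu.-negligible N -> (completed mu).-negligible N.
Proof.
move=> [M [mM M0 NM]]; exists M; split=> //; first exact: measurable_completion.
by rewrite completedE.
Qed.

Lemma completed_setU (A N : set X) : measurable A -> mu.-negligible N ->
  completed mu (A `|` N) = mu A.
Proof.
move=> mA [M [mM M0 NM]]; apply/eqP; rewrite eq_le; apply/andP; split.
  apply: (@le_trans _ _ (mu (A `|` M))); last by rewrite measureU0.
  rewrite -completedE; last exact: measurableU.
  by apply: le_outer_measure; exact: setUS.
by rewrite -completedE//; apply: le_outer_measure.
Qed.

Lemma completion_approx (B : set (completion mu)) : measurable B ->
  exists2 A : set X, measurable A & (completed mu).-negligible (B `+` A).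
Proof.
move=> [A [N [M [mA mM M0 NM ->]]]]; exists A => //.
apply: negligible_completed; exists M; split=> // x.
by move=> [[[//|/NM]]|[Ax []]] //; left.
Qed.

Variable f : X -> X.
Hypothesis mf : forall A, measurable A -> measurable (f @^-1` A).
Hypothesis fmu : forall A, measurable A -> mu (f @^-1` A) = mu A.

Let preimage_negligible N : mu.-negligible N -> mu.-negligible (f @^-1` N).
Proof.
move=> [M [mM M0 NM]]; exists (f @^-1` M); split; [exact: mf|by rewrite fmu|].
exact: preimage_subset.
Qed.

Lemma measurable_completion_preimage (B : set (completion mu)) :
  measurable B -> measurable (f @^-1` B : set (completion mu)).
Proof.
move=> [A [N [M [mA mM M0 NM ->]]]].
exists (f @^-1` A), (f @^-1` N), (f @^-1` M).
by split; [exact: mf|exact: mf|rewrite fmu|exact: preimage_subset|].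
Qed.

Lemma completed_preimage (B : set (completion mu)) :
  measurable B -> completed mu (f @^-1` B) = completed mu B.
Proof.
move=> [A [N [M [mA mM M0 NM ->]]]]; have nN : mu.-negligible N by exists M.
rewrite preimage_setU !completed_setU ?fmu//; first exact: mf.
exact: preimage_negligible.
Qed.

End completion.

(** * Cylinders of the symbolic space *)

Section symbolic_space.
Context (G : monoidType).
Local Notation Y := (symbolic_space G).

Definition cylinder (g : G) : set Y := [set y | y g].

Local Notation mC := <<s range cylinder>>.
Local Notation mY := (g_sigma_algebraType (range cylinder)).

Lemma cylinder_preimage (N : set bool) g : mC [set y : Y | N (y g)].
Proof.
have mcst (P : Prop) : mC [set y : Y | P].
  have [p|p] := pselect P.
    rewrite (_ : [set _ | _] = setT); first exact: (@measurableT _ mY).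
    by apply/seteqP; split=> // y _; exact: p.
  rewrite (_ : [set _ | _] = set0); first exact: (@measurable0 _ mY).
  by apply/seteqP; split=> // y /p.
have mg : mC (cylinder g) by apply: sub_gen_smallest; exists g.
rewrite (_ : [set _ | _] = (cylinder g `&` [set _ | N true]) `|`
    (~` cylinder g `&` [set _ | N false])).
  apply: (@measurableU _ mY);
  apply: (@measurableI _ mY);
  try exact: mcst; try exact: mg.
  exact: (@measurableC _ mY).
apply/seteqP; rewrite /cylinder; split=> y /=; case: (y g) => //=.
- by left.
- by right.
- by move=> [[]|[]].
- by move=> [[]|[]].
Qed.

Lemma eval_continuous (g : G) : continuous (fun y : Y => y g).
Proof. exact: (@proj_continuous _ (fun=> bool)). Qed.

(** The basic open sets of the product topology depend on finitely many
coordinates, so they are open members of the sigma-algebra of the cylinders. *)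
Lemma cylinder_base (U : set Y) x : open U -> U x ->
  exists W : set Y, [/\ open W, mC W, W x & W `<=` U].
Proof.
rewrite [in open U]openE => /[apply] -[_ [[Q Qfin <-] [V QV Vx] QU]].
have [L Lsub VL] := Qfin _ QV.
have LE M : M \in L -> exists g (N : set bool), open N /\ M = [set y : Y | N (y g)].
  by move=> /Lsub /set_mem [g _ [N oN <-]]; exists g, N; split.
(* V is the finite intersection of the subbasic sets listed in L. *)
exists V; split=> //; last by move=> y Vy; apply: QU; exists V.
  rewrite -VL openE => y Ly; apply: filter_bigI => M LM.
  have [g [N [oN ME]]] := LE _ LM; apply: open_nbhs_nbhs; split; last exact: Ly.
  by rewrite ME; apply: open_comp => // z _; exact: eval_continuous.
rewrite -VL; apply: (@fin_bigcap_measurable _ mY) => // M LM.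
by have [g [N [_ ->]]] := LE _ LM; exact: cylinder_preimage.
Qed.

Lemma symbolic_hausdorff : hausdorff_space Y.
Proof.
by apply: (@hausdorff_product G (fun=> bool)) => _; exact: discrete_hausdorff.
Qed.

Lemma cylinder_shift g h : symbolic_shift g @^-1` cylinder h = cylinder (h * g)%g.
Proof. by []. Qed.

Lemma shift_continuous (g : G) : continuous (@symbolic_shift G g).
Proof.
move=> y; apply/cvg_sup => h.
apply: (@continuous_comp_initial _ _ _ (fun z : Y => z h) (symbolic_shift g)).
by move=> z; exact: eval_continuous.
Qed.

Lemma measurable_cylinder_shift g D : mC D -> mC (symbolic_shift g @^-1` D).
Proof.
apply: g_sigma_algebra_preimage_sub; first exact: smallest_sigma_algebra.
by move=> _ [h _ <-]; apply: sub_gen_smallest; exists (h * g)%g.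
Qed.

Lemma measurable_cylinder_borel (D : set (borel Y)) : mC D -> measurable D.
Proof.
apply: (@smallest_sub _ _ _ <<s open>>); first exact: smallest_sigma_algebra.
move=> _ [g _ <-]; apply: sub_gen_smallest.
by apply: (@open_comp _ _ (fun y : Y => y g) is_true) => [y _|];
  [exact: eval_continuous|exact: discrete_open].
Qed.

End symbolic_space.

(** * The itinerary map *)

(** The pi-system on which the mean prescribes the measures. *)
Definition cylinder_inter (G : monoidType) : set (set (symbolic_space G)) :=
  [set D | exists r (g : 'I_r -> G), D = \bigcap_i cylinder (g i)].

Lemma cylinder_interI (G : monoidType) : setI_closed (@cylinder_inter G).
Proof.
move=> _ _ [r [g ->]] [s [h ->]].
exists (r + s)%N,
  (fun i => match fintype.split i with inl a => g a | inr b => h b end).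
apply/seteqP; split=> [y [gy hy] i _|y ghy].
  by case: (fintype.split i) => a; [exact: gy|exact: hy].
split=> i _.
- by have := ghy (unsplit (inl i)) I; rewrite unsplitK.
- by have := ghy (unsplit (inr i)) I; rewrite unsplitK.
Qed.

Lemma cylinder_cylinder_inter (G : monoidType) :
  <<s range (@cylinder G)>> `<=` <<s @cylinder_inter G>>.
Proof.
apply: smallest_sub; first exact: smallest_sigma_algebra.
move=> _ [g _ <-]; apply: sub_gen_smallest; exists 1%N, (fun=> g).
apply/seteqP; split=> [y gy _ _ //|y gy]; exact: (gy ord0 I).
Qed.

Section itinerary.
Context (R : realType) (G : monoidType) (d : measure_display)
  (X : measurableType d) (mu : probability X R) (T : mp_action G mu)
  (A : set X).
Local Notation mC := <<s range (@cylinder G)>>.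
Local Notation mY := (g_sigma_algebraType (range (@cylinder G))).

Definition itinerary (x : X) : symbolic_space G := fun g => `[< A (T g x) >].

Lemma itinerary_shift g x : itinerary (T g x) = symbolic_shift g (itinerary x).
Proof. by apply/funext => h; rewrite /itinerary mp_mul. Qed.

Lemma itinerary_cylinder g : itinerary @^-1` cylinder g = T g @^-1` A.
Proof. by apply/seteqP; split=> x; [move/asboolP|move=> Ax; apply/asboolP]. Qed.

Lemma measurable_itinerary D : measurable A -> mC D ->
  measurable (itinerary @^-1` D).
Proof.
move=> mA; apply: g_sigma_algebra_preimage_sub.
  exact: sigma_algebra_measurable.
by move=> _ [g _ <-]; rewrite itinerary_cylinder;
  exact: (measurable_preimage (T g) (MeasSet mA)).
Qed.

(** Finite intersections of cylinders form a pi-system generating the Baire sets,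
and the itinerary map pulls them back to finite intersections of translates. *)
Lemma itinerary_measure (nu : probability (borel (symbolic_space G)) R) :
  measurable A ->
  (forall r (g : 'I_r -> G), fine (nu (\bigcap_i cylinder (g i))) =
    fine (mu (\bigcap_i (T (g i) @^-1` A)))) ->
  forall D, mC D -> mu (itinerary @^-1` D) = nu D.
Proof.
move=> mA numu D /cylinder_cylinder_inter.
apply: (@eq_probability_preimage _ _ _ _ (borel (symbolic_space G)) _ nu
  itinerary (@cylinder_inter G)); first exact: cylinder_interI.
move=> _ [r [g ->]].
have mg : mC (\bigcap_i cylinder (g i)).
  apply: (@fin_bigcap_measurable _ mY) => // i _.
  by apply: sub_gen_smallest; exists (g i).
have mgb := measurable_cylinder_borel mg.
have mgX := measurable_itinerary mA mg.
split=> //; rewrite -[RHS]fineK ?fin_num_measure// -[LHS]fineK ?fin_num_measure//.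
congr (_%:E); rewrite numu; congr (fine (mu _)).
by rewrite preimage_bigcap; apply: eq_bigcapr => i _; rewrite itinerary_cylinder.
Qed.

(** The itinerary map pulls the cylinders back to the translates of A, hence the
sigma-algebra that they generate to the one generated by the translates; passing
to the completion adds only null sets. *)
Lemma itinerary_dense :
  let translates := [set T g @^-1` A | g in [set: G]] in
  measurable A ->
  measurable = <<s translates >> \/
    measurable = completion_sets <<s translates >> mu ->
  forall B : set X, measurable B ->
    exists2 D, mC D & mu.-negligible (B `+` itinerary @^-1` D).
Proof.
move=> translates mA mX B mB.
have tr_itin B' : <<s translates>> B' ->
    exists2 D, mC D & itinerary @^-1` D = B'.
  have : sigma_algebra setT (preimage_set_system setT itinerary mC).
    exact/sigma_algebra_preimage/smallest_sigma_algebra.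
  move=> sa /(_ _ (conj sa _)) []; last by move=> D mD; rewrite setTI; exists D.
  move=> _ [g _ <-]; exists (cylinder g).
    by apply: sub_gen_smallest; exists g.
  by rewrite setTI itinerary_cylinder.
case: mX => mX; move: mB; rewrite mX.
  by move=> /tr_itin[D mD <-]; exists D => //; rewrite setYK; exact: negligible_set0.
move=> [A' [N [M [/tr_itin[D mD <-] sM M0 NM ->]]]]; exists D => //.
exists M; split=> //.
  rewrite mX; exists M, set0, set0; split=> //; rewrite ?setU0//; last first.
  exact: (@measurable0 _ (g_sigma_algebraType translates)).
by move=> x [[[//|/NM]]|[Dx []]] //; left.
Qed.

End itinerary.

(** * The conjugacy *)

Theorem theorem4p4 (R : realType) (G : monoidType)
  (amenG : left_amenable R G)
  (m : {linear ell_infty R G -> R[i]^o}) (mean_m : left_invariant_mean m)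
  (E : set G) (E_gt0 : 0 < m (ell_indic R E))
  (d : measure_display) (X : measurableType d) (mu : probability X R)
  (T : mp_action G mu) (furst_T : furstenberg_system E m T)
  (nu : probability (borel (symbolic_space G)) R)
  (symb_nu : symbolic_measure E m nu) :
  exists S : mp_action G (completed nu),
    (forall g x, S g x = symbolic_shift g x) /\ conjugate_systems T S.
Proof.
have [A [mA _ muA mX]] := furst_T; have [nu_reg nuE] := symb_nu.
pose C := range (@cylinder G).
have mCborel := @measurable_cylinder_borel G.
have numu r (g : 'I_r -> G) : fine (nu (\bigcap_i cylinder (g i))) =
    fine (mu (\bigcap_i (T (g i) @^-1` A))).
  apply: complexI; rewrite -muA -nuE; congr ((fine (nu _))%:C).
  by apply: eq_bigcapr => i _; rewrite cylinder_shift mul1g.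
have fmu := itinerary_measure mA numu.
have mC_shift := @measurable_cylinder_shift G.
(* On the cylinder sigma-algebra the shift inherits invariance from T. *)
have shiftC g D : <<s C>> D -> nu (symbolic_shift g @^-1` D) = nu D.
  move=> mD; rewrite -fmu; last exact: mC_shift.
  rewrite -[RHS]fmu// -[RHS](mp_measure T g); last exact: measurable_itinerary.
  by congr (mu _); apply/funext => x; rewrite /preimage/= itinerary_shift.
have shift_nu g : forall B : set (borel (symbolic_space G)), measurable B ->
    nu (symbolic_shift g @^-1` B) = nu B.
  exact: (regular_invariant nu_reg (@symbolic_hausdorff G) (@cylinder_base G)
    mCborel (@shift_continuous G g) (shiftC g)).
have shift_borel g (B : set (borel (symbolic_space G))) : measurable B ->
    measurable (symbolic_shift g @^-1` B : set (borel (symbolic_space G))).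
  exact: (continuous_borel_preimage (@shift_continuous G g)).
have Smfun g : (@symbolic_shift G g : completion nu -> completion nu) \in mfun.
  apply/mem_set => _ B mB; rewrite setTI.
  exact: measurable_completion_preimage (shift_borel g) (shift_nu g) _ mB.
have S_measure g (B : set (completion nu)) : measurable B ->
    completed nu (mfun_Sub (Smfun g) @^-1` B) = completed nu B.
  exact: completed_preimage (shift_borel g) (shift_nu g) _.
have S_mul g h x : mfun_Sub (Smfun g) (mfun_Sub (Smfun h) x) =
    mfun_Sub (Smfun (g * h)%g) x.
  by apply/funext => k; rewrite /= /symbolic_shift mulgA.
have S_one x : mfun_Sub (Smfun 1%g) x = x.
  by apply/funext => k; rewrite /= /symbolic_shift mulg1.
pose S : mp_action G (completed nu) := MPAction S_measure S_mul S_one.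
exists S; split=> //.
apply: (@conjugate_factor _ _ _ X (completion nu) mu (completed nu) C
  (itinerary T A)).
- by move=> D mD; apply: measurable_completion; exact: mCborel.
- by move=> D; exact: measurable_itinerary.
- by move=> D mD; exact: etrans (fmu D mD) (esym (completedE nu (mCborel D mD))).
- move=> B /completion_approx[B' mB' BB'].
  have [D mD B'D] := regular_approx nu_reg (@symbolic_hausdorff G)
    (@cylinder_base G) mB'.
  exists D => //; apply: negligibleS (negligibleU BB' (negligible_completed B'D)).
  move=> x [[Bx Dx]|[Dx Bx]]; have [B'x|B'x] := pselect (B' x);
    by [left; left|left; right|right; left|right; right].
- exact: itinerary_dense.
- by move=> g x; rewrite itinerary_shift.
- by move=> g D mD; exact: mC_shift.
Qed.
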